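(* Let buyer types $(\theta,v)$ be distributed with density $f(\theta,v)=\tfrac12$ on the region $\{0\le v-\theta\le 1,\ 0\le\theta\le 2\}$ and $f=0$ elsewhere. Then the pricing scheme $$p(t)=\begin{cases}4/3, & t\in[0,1),\\ 2/3, & t\ge 1\end{cases}$$ is optimal, i.e. it maximizes expected revenue over all non-increasing pricing functions. Its separation function, which is the optimal separation line, is $$\ell_p(\theta)=\begin{cases}2/3+\theta, & 0\le\theta\le 2/3,\\ 4/3, & \theta>2/3.\end{cases}$$
   Context: Model: a seller sells identical items in unlimited supply to unit-demand buyers with types $(\theta,v)$. Here $\theta\ge0$ is the cost per unit time and $v$ the valuation. A pricing scheme is a non-increasing function $p:[0,\infty)\to\mathbb{R}$: spending time $t$ costs price $p(t)$. A buyer of type $(\theta,v)$ chooses $t^*(\theta)$, the smallest minimizer of $p(t)+\theta t$ over $t\ge0$, buys iff $p(t^*(\theta))+\theta t^*(\theta)\le v$, and then pays $p(t^*(\theta))$. The seller maximizes the expected payment. The separation function of $p$ is $\ell_p(\theta)=\min_{t\ge0}\{p(t)+\theta t\}$: a buyer of type $(\theta,v)$ buys iff $v\ge\ell_p(\theta)$, and she then pays $\ell_p(\theta)-\theta\ell_p'(\theta)$. *)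

(* Defs.v *)
From mathcomp Require Import all_boot all_order all_algebra.
From mathcomp Require Import all_classical all_reals all_analysis.
Set Implicit Arguments. Unset Strict Implicit. Unset Printing Implicit Defensive.
Import Order.TTheory GRing.Theory Num.Theory.
Local Open Scope classical_set_scope.
Local Open Scope ring_scope.

Section Pricing.
Variable R : realType.

Definition nonincreasing_scheme (p : R -> R) : Prop :=
  forall s t : R, 0 <= s -> s <= t -> p t <= p s.

Definition smallest_minimizer (p : R -> R) (theta t : R) : Prop :=
  [/\ 0 <= t,
      (forall s, 0 <= s -> p t + theta * t <= p s + theta * s) &
      (forall s, 0 <= s -> p s + theta * s = p t + theta * t -> t <= s)].

(* the buyer's choice t*(theta) (meaningful when a smallest minimizer exists) *)
Definition tstar (p : R -> R) (theta : R) : R :=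
  xget 0 (smallest_minimizer p theta).

(* the buyer's behaviour is well defined: t*(theta) exists for every theta > 0
   (theta = 0 is a null set for the distribution below) *)
Definition well_defined_scheme (p : R -> R) : Prop :=
  forall theta, 0 < theta -> exists t, smallest_minimizer p theta t.

Definition payment (p : R -> R) (theta v : R) : R :=
  let t := tstar p theta in
  if (p t + theta * t <= v) then p t else 0.

Definition support : set (R * R) :=
  [set x | 0 <= x.1 <= 2 /\ 0 <= x.2 - x.1 <= 1].

Definition density (x : R * R) : R := if `[< support x >] then 2^-1 else 0.

Definition revenue (p : R -> R) : \bar R :=
  (\int[(@lebesgue_measure R) \x (@lebesgue_measure R)]_(x in [set: R * R])
     (density x * payment p x.1 x.2)%:E)%E.

Definition separation (p : R -> R) (theta : R) : R :=
  inf [set p t + theta * t | t in [set t : R | 0 <= t]].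

End Pricing.

Definition p_opt {R : realType} (t : R) : R :=
  if t < 1 then 4 / 3 else 2 / 3.

(* Main.v *)
(* Let l be the separation line, w = l - theta, D = clamp (1 - w) the probability
   of a sale at cost theta. The revenue is half the integral over [0, 2] of
   (w - theta w') D. With T the antiderivative of - clamp (1 - w) vanishing for
   w >= 1, integration by parts gives
     2 revenue = 2 T (w 2) + integral of (w D - T w).
   The function phi w = w clamp (1 - w) - T w is maximal at w = 2/3, and since l
   is nondecreasing w <= c - theta with c = l 2, so phi w is at most
   phi (min (2/3) (c - theta)); the resulting bound in c is maximal at c = 4/3,
   where it equals 44/27, which is attained by p_opt. Everything is done on a
   uniform grid of mesh h: the revenue of any scheme is at most 22/27 + O(h), and
   that of p_opt at least 22/27 - O(h), comparing the integrand with finite sums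
   of indicators of boxes. *)
Require Import Defs.
From mathcomp Require Import all_boot all_order all_algebra.
From mathcomp Require Import all_classical all_reals all_analysis.
From mathcomp Require Import measurable_realfun.
From mathcomp Require Import ring lra.
Import Order.TTheory GRing.Theory Num.Theory.
Local Open Scope ring_scope.

(** * Integrals of finite sums of box indicators *)

Section BoxIntegral.
Context {R : realType}.
Local Open Scope classical_set_scope.
Local Open Scope ereal_scope.
Notation leb := (@lebesgue_measure R).

(* No measurability of [f] is assumed: the integral of a nonnegative function is
   a supremum over the simple functions below it. *)
Lemma le_integral_nonmeasurable {d : measure_display} {T : measurableType d}
    (mu : {measure set T -> \bar R}) (f g : T -> \bar R) :
  (forall x, 0 <= g x) -> (forall x, f x <= g x) ->
  \int[mu]_(x in setT) f x <= \int[mu]_(x in setT) g x.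
Proof.
move=> g0 fg; rewrite integralE.
apply: (@le_trans _ _ (\int[mu]_(x in setT) (f^\+ x))).
  by rewrite geeDl // oppe_le0 integral_ge0.
rewrite !ge0_integralTE //; apply: ereal_sup_le => _ [h hf <-]; exists h => //=.
by move=> x; apply: le_trans (hf x) _; rewrite funeposE ge_max fg g0.
Qed.

Definition boxes (n : nat) (k : nat -> R) (A B : nat -> set R) (x : R * R) : R :=
  (\sum_(i < n) k i * \1_(A i `*` B i) x)%R.

Lemma integral_boxes (n : nat) (k : nat -> R) (A B : nat -> set R) (a b : nat -> R) :
  (forall i, (0 <= k i)%R) ->
  (forall i, measurable (A i)) -> (forall i, measurable (B i)) ->
  (forall i, leb (A i) = (a i)%:E) -> (forall i, leb (B i) = (b i)%:E) ->
  \int[leb \x leb]_(x in setT) (boxes n k A B x)%:E =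
  (\sum_(i < n) k i * (a i * b i))%:E.
Proof.
move=> k0 mA mB eA eB.
have mAB i : measurable (A i `*` B i) by exact: measurableX.
under eq_integral => x _ do rewrite /boxes -sumEFin.
rewrite ge0_integral_sum //; last 2 first.
- move=> i; apply/measurable_EFinP; apply: measurable_funM; first exact: measurable_cst.
  by apply: measurable_indic; exact: mAB.
- by move=> i x _; rewrite lee_fin mulr_ge0.
rewrite -sumEFin; apply: eq_bigr => i _.
under eq_integral => x _ do rewrite EFinM.
rewrite ge0_integralZl_EFin //; last first.
  by apply/measurable_EFinP/measurable_indic; exact: mAB.
rewrite integral_indic ?setIT; [|exact: measurableT|exact: mAB].
rewrite !EFinM; congr (_ * _); rewrite [LHS]product_measure1E.
- exact: (congr2 _ (eA i) (eB i)).
- exact: mA.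
- exact: mB.
Qed.

(** The maximum with 0 covers empty intervals, which occur when the separation line leaves no room
    for a sale. *)
Lemma lebesgue_measure_itv_max (b : bool) (x y : R) :
  leb [set` Interval (BLeft x) (BSide b y)] = (Num.max 0 (y - x))%:E.
Proof.
rewrite lebesgue_measure_itv /= lte_fin; case: ltP => xy.
  by rewrite max_r ?subr_ge0 1?ltW.
by rewrite max_l // subr_le0.
Qed.

Local Open Scope ring_scope.

Lemma boxes_ge (n : nat) (k : nat -> R) (A B : nat -> set R) (x : R * R) (i : nat) :
  (forall j, 0 <= k j) -> (i < n)%N -> A i x.1 -> B i x.2 -> k i <= boxes n k A B x.
Proof.
move=> k0 ltin Ai Bi; rewrite /boxes (bigD1 (Ordinal ltin)) //=.
rewrite indicE mem_set ?mulr1; last by split.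
by rewrite lerDl sumr_ge0 // => j _; rewrite mulr_ge0.
Qed.

Lemma boxes_ge0 (n : nat) (k : nat -> R) (A B : nat -> set R) (x : R * R) :
  (forall j, 0 <= k j) -> 0 <= boxes n k A B x.
Proof. by move=> k0; rewrite sumr_ge0 // => j _; rewrite mulr_ge0. Qed.

(** Disjoint columns [A i] leave at most one nonzero term of the sum at any point. *)
Lemma le_boxes (n : nat) (k : nat -> R) (A B : nat -> set R) (x : R * R) (f : R) :
  0 <= f -> (forall i j, A i x.1 -> A j x.1 -> i = j) ->
  (forall i, (i < n)%N -> A i x.1 -> B i x.2 -> k i <= f) -> boxes n k A B x <= f.
Proof.
move=> f0 disj kf; rewrite /boxes.
have [[i [Ai Bi]]|none] := pselect (exists i : 'I_n, A i x.1 /\ B i x.2).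
  rewrite (bigD1 i) //= big1 => [|j ji].
    by rewrite addr0 indicE mem_set ?mulr1; [exact: kf (ltn_ord i) Ai Bi|split].
  rewrite indicE memNset ?mulr0 // => -[/= Aj _].
  by move/eqP: ji; apply; apply/val_inj; exact: disj Aj Ai.
rewrite big1 // => i _; rewrite indicE memNset ?mulr0 // => -[/= Ai Bi].
by apply: none; exists i.
Qed.

End BoxIntegral.

(** * Convexity of [tail] and tangent bounds for [virtual] *)

Section Certificate.
Context {R : realType}.

Definition clamp (x : R) : R := if x <= 0 then 0 else if x <= 1 then x else 1.

(* The integral of [clamp (1 - s)] over [s >= w]. *)
Definition tail (w : R) : R :=
  if w <= 0 then 1 / 2 - w else if w <= 1 then (1 - w) ^+ 2 / 2 else 0.

Definition virtual (w : R) : R := w * clamp (1 - w) - tail w.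

Lemma clamp_cases (x : R) :
  [\/ x <= 0 /\ clamp x = 0, 0 <= x <= 1 /\ clamp x = x | 1 <= x /\ clamp x = 1].
Proof.
rewrite /clamp; have [x0|x0] := leP x 0.
  by apply: Or31; split => //; lra.
have [x1|x1] := leP x 1; [apply: Or32|apply: Or33]; split; lra.
Qed.

Lemma tail_cases (w : R) :
  [\/ [/\ w <= 0, tail w = 1 / 2 - w & clamp (1 - w) = 1],
      [/\ 0 <= w, w <= 1, tail w = (1 - w) ^+ 2 / 2 & clamp (1 - w) = 1 - w]
    | [/\ 1 <= w, tail w = 0 & clamp (1 - w) = 0]].
Proof.
rewrite /tail; have [w0|w0] := leP w 0.
  by apply: Or31; split => //; case: (clamp_cases (1 - w)) => -[? ->]; lra.
by have [w1|w1] := leP w 1; [apply: Or32|apply: Or33]; split => //;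
  try (case: (clamp_cases (1 - w)) => -[? ->]); lra.
Qed.

Lemma clamp_ge0 (x : R) : 0 <= clamp x.
Proof. by case: (clamp_cases x) => -[? ->]; lra. Qed.

Lemma clamp_le1 (x : R) : clamp x <= 1.
Proof. by case: (clamp_cases x) => -[? ->]; lra. Qed.

Lemma tail_ge0 (w : R) : 0 <= tail w.
Proof. by case: (tail_cases w) => -[? ? ?]; nra. Qed.

Lemma tail_le (w : R) : 0 <= w -> tail w <= 1 / 2.
Proof. by move=> w0; case: (tail_cases w) => -[? ? ?]; nra. Qed.

(** [tail] has the nondecreasing derivative [- clamp (1 - w)], so it lies above its tangents. *)
Lemma tail_convex (w w' : R) : tail w - clamp (1 - w) * (w' - w) <= tail w'.
Proof.
have := sqr_ge0 (w - w'); have := sqr_ge0 w; have := sqr_ge0 w'.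
by case: (tail_cases w) => -[? ]; [move=> -> ->|move=> ? -> ->|move=> -> ->];
  case: (tail_cases w') => -[? ]; (move=> ? -> || move=> ->) => ?; nra.
Qed.

Lemma virtual_cases (w : R) :
  [\/ w <= 0 /\ virtual w = 2 * w - 1 / 2,
      0 <= w <= 1 /\ virtual w = 2 * w - 3 / 2 * w ^+ 2 - 1 / 2
    | 1 <= w /\ virtual w = 0].
Proof.
rewrite /virtual; case: (tail_cases w) => -[].
- by move=> ? -> ->; apply: Or31; split => //; lra.
- by move=> ? ? -> ->; apply: Or32; split; [lra|field].
- by move=> ? -> ->; apply: Or33; split => //; ring.
Qed.

Lemma virtual_le (w : R) : virtual w <= 1 / 6.
Proof.
by have := sqr_ge0 (w - 2 / 3); case: (virtual_cases w) => -[? ->]; nra.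
Qed.

(** [virtual] is not concave: its slope jumps from -1 to 0 at 1. For [e <= 2 / 3] the tangent is
    nondecreasing and worth 3/2 (1 - e)^2 at 1, so it stays above 0 from there on. *)
Lemma virtual_tangent (e w : R) : 0 <= e <= 2 / 3 ->
  virtual w <= 2 * e - 3 / 2 * e ^+ 2 - 1 / 2 + (2 - 3 * e) * (w - e).
Proof.
move=> /andP[e0 e1]; have := sqr_ge0 (w - e).
case: (virtual_cases w) => -[w01 ->].
- have : 0 <= e * (e - 2 * w) by apply: mulr_ge0; lra.
  lra.
- by nra.
- have : 0 <= (2 - 3 * e) * (w - 1) by apply: mulr_ge0; lra.
  by have := sqr_ge0 (1 - e); nra.
Qed.

(* For [w] ranging over [w <= c - x] the maximum of [virtual w] is bounded by its
   tangent at [min (2/3) (4/3 - x)], the value taken by the optimal line; the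
   potential is the antiderivative in [x] of this tangent bound. *)
Definition potential (c x : R) : R :=
  if x <= 2 / 3 then x / 6
  else if x <= 4 / 3 then
    x / 6 - (x - 2 / 3) ^+ 3 / 2 + (c - 4 / 3) * (3 / 2) * (x - 2 / 3) ^+ 2
  else 2 / 27 - (x - 4 / 3) ^+ 2 - (x - 4 / 3) / 2
       + (c - 4 / 3) * (2 / 3 + 2 * (x - 4 / 3)).

(** The bound on [virtual w] at [x] is the derivative of the potential there, so the error over a
    cell is of second order. The two disjunctions keep the cell from straddling 2/3 or 4/3. *)
Lemma virtual_step (c x y w : R) : 0 <= c <= 2 -> 0 <= x -> x < y -> y <= 2 ->
  y <= 2 / 3 \/ 2 / 3 <= x -> y <= 4 / 3 \/ 4 / 3 <= x -> w <= c - x ->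
  (y - x) * virtual w <= potential c y - potential c x + 10 * (y - x) ^+ 2.
Proof.
move=> c02 x0 xy y2 c1 c2 wc.
have pos1 : 0 < y - x by lra.
have [y1|y1] := leP y (2 / 3).
  rewrite /potential !ifT; [|lra..].
  have := ler_wpM2l (ltW pos1) (virtual_le w); have := sqr_ge0 (y - x); lra.
have {c1} x1 : 2 / 3 <= x by lra.
have [y43|y43] := leP y (4 / 3).
  have -> : potential c y = y / 6 - (y - 2 / 3) ^+ 3 / 2
      + (c - 4 / 3) * (3 / 2) * (y - 2 / 3) ^+ 2.
    by rewrite /potential ifF ?ifT //; apply/negbTE; rewrite -ltNge.
  have -> : potential c x = x / 6 - (x - 2 / 3) ^+ 3 / 2
      + (c - 4 / 3) * (3 / 2) * (x - 2 / 3) ^+ 2.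
    rewrite /potential; case: leP => [?|_]; last by rewrite ifT //; lra.
    by rewrite (_ : x = 2 / 3); [field|lra].
  have H : virtual w <= 1 / 6 - 3 / 2 * (x - 2 / 3) ^+ 2 + (c - 4 / 3) * (3 * x - 2).
    (* The tangent at 4/3 - x has slope 3 x - 2 >= 0, so [w] may be replaced by its upper bound
       [c - x]. *)
    have e01 : 0 <= 4 / 3 - x <= 2 / 3 by lra.
    have := virtual_tangent _ w e01.
    have : 0 <= (3 * x - 2) * (c - x - w) by apply: mulr_ge0; lra.
    nra.
  have := ler_wpM2l (ltW pos1) H.
  (* Higher-order Taylor terms of the cubic at [x], together with the allowance 10. *)
  have : 0 <= (y - x) ^+ 2 * (10 + 3 / 2 * (c - 4 / 3) - 3 / 2 * (x - 2 / 3) - (y - x) / 2).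
    by apply: mulr_ge0; [exact: sqr_ge0|lra].
  lra.
have {c2} x43 : 4 / 3 <= x by lra.
have -> : potential c y = 2 / 27 - (y - 4 / 3) ^+ 2 - (y - 4 / 3) / 2
    + (c - 4 / 3) * (2 / 3 + 2 * (y - 4 / 3)).
  by rewrite /potential !ifF //; apply/negbTE; rewrite -ltNge; lra.
have -> : potential c x = 2 / 27 - (x - 4 / 3) ^+ 2 - (x - 4 / 3) / 2
    + (c - 4 / 3) * (2 / 3 + 2 * (x - 4 / 3)).
  rewrite /potential ifF; last by apply/negbTE; rewrite -ltNge; lra.
  case: leP => x43' //.
  by rewrite (_ : x = 4 / 3); [field|lra].
(* Now 4/3 - x <= 0, where [virtual] is affine and coincides with its tangent at 0. *)
have e0 : 0 <= (0 : R) <= 2 / 3 by lra.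
have H : virtual w <= 2 * (c - x) - 1 / 2 by have := virtual_tangent _ w e0; lra.
have := ler_wpM2l (ltW pos1) H; have := sqr_ge0 (y - x); lra.
Qed.
End Certificate.

(** * Summation by parts on a uniform grid *)

Section RevenueSums.
Context {R : realType}.
Variable m : nat.
Hypothesis m_gt0 : (0 < m)%N.

(** This mesh places 2/3, 4/3 and 2 at the nodes m, 2m and 3m. *)
Definition step : R := 2 / (3 * m%:R).
Definition node (i : nat) : R := step * i%:R.

Lemma mR_gt0 : (0 : R) < m%:R. Proof. by rewrite ltr0n. Qed.

Lemma step_gt0 : 0 < step.
Proof. by rewrite divr_gt0 // mulr_gt0 // mR_gt0. Qed.

Lemma nodeS (i : nat) : node i.+1 = node i + step.
Proof. by rewrite /node -natr1 mulrDr mulr1. Qed.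

Lemma node_le (i j : nat) : (i <= j)%N -> node i <= node j.
Proof. by move=> ij; rewrite ler_pM2l ?step_gt0 // ler_nat. Qed.

Lemma node0 : node 0 = 0. Proof. by rewrite /node mulr0. Qed.

Lemma node1 : node 1 = step. Proof. by rewrite /node mulr1. Qed.

Lemma node_ge0 (i : nat) : 0 <= node i.
Proof. by rewrite -node0 node_le. Qed.

Lemma node_gt0 (i : nat) : (0 < i)%N -> 0 < node i.
Proof. by move=> i0; apply: lt_le_trans step_gt0 _; rewrite -node1 node_le. Qed.

Lemma node_m : node m = 2 / 3.
Proof. by rewrite /node /step; have := mR_gt0 => ?; field; rewrite lt0r_neq0. Qed.

Lemma node_2m : node (2 * m) = 4 / 3.
Proof.
by rewrite /node /step natrM; have := mR_gt0 => ?; field; rewrite lt0r_neq0.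
Qed.

Lemma node_3m : node (3 * m) = 2.
Proof.
by rewrite /node /step natrM; have := mR_gt0 => ?; field; rewrite lt0r_neq0.
Qed.

Lemma step_le : step <= 2 / 3.
Proof. by rewrite -node_m -node1 node_le. Qed.

Lemma node_split (i j : nat) : node i.+1 <= node j \/ node j <= node i.
Proof. by case: (leqP j i) => ij; [right|left]; exact: node_le. Qed.

Lemma node_cell (n : nat) (x : R) : (0 < n)%N -> 0 <= x <= node n ->
  exists2 i, (i < n)%N & node i <= x <= node i.+1.
Proof.
elim: n => // -[_ _|n IH _] /andP[x0 xn].
  by exists 0%N; rewrite // node0 x0.
have [xn1|xn1] := leP x (node n.+1).
  by have [i ni ix] := IH isT (introT andP (conj x0 xn1)); exists i; rewrite // ltnW.
by exists n.+1; rewrite // (ltW xn1).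
Qed.

Lemma ler_telescope (f F : nat -> R) (a b : nat) : (a <= b)%N ->
  (forall i, (a <= i < b)%N -> f i <= F i.+1 - F i) ->
  \sum_(a <= i < b) f i <= F b - F a.
Proof. by move=> ab fF; rewrite -telescope_sumr // ler_sum_nat. Qed.

Variables (l r : R -> R).
Hypothesis l_homo : forall x y, 0 < x -> x <= y -> l x <= l y.
Hypothesis l_ge0 : forall x, 0 < x -> 0 <= l x.
Hypothesis r_ge0 : forall x, 0 < x -> 0 <= r x.
Hypothesis r_homo : forall x y, 0 < x -> x <= y -> r x <= r y.
(** Discrete form of r <= l - x l', where [l] is the separation line and [r] the price paid. *)
Hypothesis envelope : forall x y, 0 < x -> x < y ->
  r x * (y - x) <= y * l x - x * l y.

Definition demand (x : R) : R := clamp (1 - (l x - x)).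

(* The envelope inequality turns [- x * l' * demand] into a difference of
   [tail], by convexity of [tail]; summing over the grid is then a summation by
   parts, so that no derivative of [l] is needed. *)
Lemma revenue_step (x y : R) : 0 < x -> x < y ->
  (y - x) * (r x * demand x) <=
  (y - x) * virtual (l x - x)
  + (x * tail (l y - y) - (x - (y - x)) * tail (l x - x)).
Proof.
move=> x0 xy; have := envelope _ _ x0 xy; rewrite /demand.
set w := l x - x; set w' := l y - y => env.
have H1 := ler_wpM2r (clamp_ge0 (1 - w)) env.
have H2 := ler_wpM2l (ltW x0) (tail_convex w w').
rewrite /virtual; rewrite /w' /w in H1 H2 *; lra.
Qed.

(* If [l 2 <= 2], the terms in [l 2] of the potential and of [tail (l 2 - 2)]
   cancel; if [l 2 >= 2], the crude bounds [virtual <= 1/6], [tail <= 1/2] give 4/3. *)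
Lemma revenue_sum :
  \sum_(1 <= i < 3 * m) step * (r (node i) * demand (node i))
    <= 44 / 27 + 20 * step.
Proof.
have s0 := step_gt0; have s1 := step_le; have n3 := node_3m.
have m3 : (1 <= 3 * m)%N by rewrite muln_gt0.
set c := l 2.
have c0 : 0 <= c by apply: l_ge0.
have wc i : (1 <= i < 3 * m)%N -> l (node i) - node i <= c - node i.
  move=> /andP[i1 i2]; rewrite lerD2r; apply: l_homo; first exact: node_gt0.
  by rewrite -n3 node_le // ltnW.
have stepE i : step = node i.+1 - node i by rewrite nodeS; ring.
(* Writing [node i] as [node i.+1 - step] turns the [tail] terms into a telescoping difference. *)
have rstep i : (1 <= i < 3 * m)%N -> step * (r (node i) * demand (node i)) <=
    step * virtual (l (node i) - node i) +
    ((node i.+1 - step) * tail (l (node i.+1) - node i.+1)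
      - (node i - step) * tail (l (node i) - node i)).
  move=> /andP[i1 i2].
  have lt : node i < node i.+1 by rewrite nodeS ltrDl.
  have := revenue_step _ _ (node_gt0 _ i1) lt.
  by rewrite -stepE nodeS addrK.
have [c2|c2] := leP 2 c.
  pose F i := node i / 6 + (node i - step) * tail (l (node i) - node i).
  apply: (@le_trans _ _ (F (3 * m)%N - F 1%N)).
    apply: ler_telescope => // i i12; apply: le_trans (rstep _ i12) _.
    have := ler_wpM2l (ltW s0) (virtual_le (l (node i) - node i)).
    by have := nodeS i; rewrite /F; lra.
  rewrite /F node1 n3 -/c; have := tail_le (c - 2); have := tail_ge0 (c - 2).
  by move=> h1 h2; have := h2 ltac:(lra); nra.
(* The middle term collects the error [10 * step ^+ 2] of each cell, at most [20 * step] in all. *)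
pose F i := potential c (node i) + 10 * step * node i
            + (node i - step) * tail (l (node i) - node i).
apply: (@le_trans _ _ (F (3 * m)%N - F 1%N)).
  apply: ler_telescope => // i i12; apply: le_trans (rstep _ i12) _.
  have /andP[i1 i2] := i12.
  have H : step * virtual (l (node i) - node i) <=
      potential c (node i.+1) - potential c (node i) + 10 * step ^+ 2.
    rewrite (stepE i); apply: virtual_step.
    - by rewrite c0 ltW.
    - exact: node_ge0.
    - by rewrite nodeS ltrDl.
    - by rewrite -n3 node_le.
    - by rewrite -node_m; exact: node_split.
    - by rewrite -node_2m; exact: node_split.
    - exact: wc.
  have E : step * node i.+1 = step * node i + step ^+ 2 by rewrite nodeS; ring.
  by rewrite /F; lra.
rewrite /F node1 n3 -/c.
have -> : potential c step = step / 6 by rewrite /potential s1.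
have -> : potential c 2 = - (19 / 27) + 2 * (c - 4 / 3).
  by rewrite /potential !ifF; [field|apply/negbTE; rewrite -ltNge; lra..].
have tE : 0 <= tail (c - 2) /\ tail (c - 2) = 5 / 2 - c.
  by split; [exact: tail_ge0|case: (tail_cases (c - 2)) => -[]; lra].
have [t0 tE'] := tE; nra.
Qed.

(** Covering boxes take the price at the right end of a cell and slightly more than the demand at
    the left end. With prices capped at 3, the largest valuation in the support, the shift of price
    telescopes to 3 steps and the extra demand costs 6: 29 = 20 + 3 + 6. *)
Lemma upper_sum :
  \sum_(1 <= i < 3 * m) Num.min (r (node i.+1)) 3 * (step * (demand (node i) + step))
    <= 44 / 27 + 29 * step.
Proof.
have s0 := step_gt0; have n3 := node_3m.
have m3 : (1 <= 3 * m)%N by rewrite muln_gt0.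
pose M i := Num.min (r (node i)) 3.
apply: (@le_trans _ _ (\sum_(1 <= i < 3 * m)
   (step * (r (node i) * demand (node i)) +
     ((step * M i.+1 + 3 * step * node i.+1) - (step * M i + 3 * step * node i))))).
  apply: ler_sum_nat => i /andP[i1 i2]; rewrite -/(M _).
  have M3 : M i.+1 <= 3 by rewrite ge_min lexx orbT.
  have Mr : M i <= r (node i) by rewrite ge_min lexx.
  have MM : M i <= M i.+1.
    rewrite le_min !ge_min lexx orbT andbT r_homo //; first exact: node_gt0.
    exact: node_le.
  have d0 : 0 <= demand (node i) := clamp_ge0 _.
  have d1 : demand (node i) <= 1 := clamp_le1 _.
  rewrite [node i.+1]nodeS.
  have H1 : 0 <= step * (demand (node i) * (r (node i) - M i)).
    by rewrite !mulr_ge0 ?subr_ge0 // ltW.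
  have H2 : 0 <= step * ((1 - demand (node i)) * (M i.+1 - M i)).
    by rewrite !mulr_ge0 ?subr_ge0 // ltW.
  have H3 : 0 <= step * (step * (3 - M i.+1)).
    by rewrite !mulr_ge0 ?subr_ge0 // ltW.
  lra.
rewrite big_split /= telescope_sumr // n3 node1.
have M3 : M (3 * m)%N <= 3 by rewrite ge_min lexx orbT.
have M1 : 0 <= M 1%N by rewrite /M le_min r_ge0 ?node1 //=; lra.
have := revenue_sum.
have := ler_wpM2l (ltW s0) M3; have := ler_wpM2l (ltW s0) M1.
nra.
Qed.

End RevenueSums.

(** * Separation functions of nonnegative prices *)

Section Envelope.
Context {R : realType}.
Local Open Scope classical_set_scope.
Variable p : R -> R.
Hypothesis p_ge0 : forall t, 0 <= t -> 0 <= p t.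

Lemma separation_le (x t : R) : 0 <= x -> 0 <= t ->
  separation p x <= p t + x * t.
Proof.
move=> x0 t0; apply: ge_inf; last by exists t.
by exists 0 => _ [s /= s0 <-]; rewrite addr_ge0 ?p_ge0 ?mulr_ge0.
Qed.

Lemma le_separation (q : R -> R) (x b : R) :
  (forall t, 0 <= t -> b <= q t + x * t) -> b <= separation q x.
Proof.
move=> bp; apply: lb_le_inf; first by exists (q 0 + x * 0); exists 0 => /=.
by move=> _ [t /= t0 <-]; exact: bp.
Qed.

Lemma separation_homo (x y : R) : 0 < x -> x <= y ->
  separation p x <= separation p y.
Proof.
move=> x0 xy; apply: le_separation => t t0.
apply: le_trans (separation_le _ _ (ltW x0) t0) _.
by rewrite lerD2l ler_wpM2r.
Qed.

Lemma separation_ge0 (x : R) : 0 < x -> 0 <= separation p x.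
Proof.
by move=> x0; apply: le_separation => t t0; rewrite addr_ge0 ?p_ge0 ?mulr_ge0 // ltW.
Qed.

End Envelope.

(** * The buyer's choice and the truncated price *)

Section Scheme.
Context {R : realType}.
Local Open Scope classical_set_scope.

Lemma separation_min (p : R -> R) (x t : R) : 0 <= t ->
  (forall s, 0 <= s -> p t + x * t <= p s + x * s) ->
  separation p x = p t + x * t.
Proof.
move=> t0 tmin; apply/eqP; rewrite eq_le; apply/andP; split.
  by apply: ge_inf; [exists (p t + x * t) => _ [s /= s0 <-]; exact: tmin|exists t].
exact: le_separation.
Qed.

(** Without a minimizer, as may happen at cost 0, [xget] returns its default 0. *)
Lemma tstar_ge0 (p : R -> R) (x : R) : 0 <= tstar p x.
Proof. by rewrite /tstar; case: xgetP => [t _ []|]. Qed.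

Lemma tstar_eq (p : R -> R) (x t : R) : smallest_minimizer p x t -> tstar p x = t.
Proof.
move=> tm; have [t0 t1 t2] := tm; rewrite /tstar; case: xgetP => [s _|/(_ t)//].
move=> [s0 s1 s2]; apply/eqP; rewrite eq_le.
have E : p t + x * t = p s + x * s by apply/eqP; rewrite eq_le t1 ?s1.
by rewrite t2 ?s2.
Qed.

Variable q : R -> R.
Hypothesis q_noninc : nonincreasing_scheme q.
Hypothesis q_wd : well_defined_scheme q.

(* Negative prices only lose revenue; truncating them at 0 keeps the separation
   function nonnegative, so that nothing blows up as theta tends to 0. *)
Definition trunc_scheme (t : R) : R := Num.max 0 (q t).

(** The time is still chosen against [q]; only the price is truncated. *)
Definition rate (x : R) : R := trunc_scheme (tstar q x).

Lemma trunc_scheme_ge0 (t : R) : 0 <= t -> 0 <= trunc_scheme t.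
Proof. by rewrite le_max lexx. Qed.

Lemma le_trunc_scheme (t : R) : q t <= trunc_scheme t.
Proof. by rewrite le_max lexx orbT. Qed.

Lemma tstarP (x : R) : 0 < x -> smallest_minimizer q x (tstar q x).
Proof. by move=> x0; have [t tm] := q_wd _ x0; rewrite (tstar_eq _ _ _ tm). Qed.

(** Revealed preference: adding the two optimality inequalities shows that a higher cost per unit
    time means no more time spent. *)
Lemma rate_homo (x y : R) : 0 < x -> x <= y -> rate x <= rate y.
Proof.
move=> x0; rewrite le_eqVlt => /predU1P[-> //|xy].
have y0 := lt_trans x0 xy.
have [s0 s1 _] := tstarP _ x0; have [t0 t1 _] := tstarP _ y0.
set s := tstar q x in s0 s1 *; set t := tstar q y in t0 t1 *.
have ts : t <= s.
  have := s1 _ t0; have := t1 _ s0 => h1 h2; rewrite leNgt; apply/negP => st.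
  have : 0 < (y - x) * (t - s) by rewrite mulr_gt0 ?subr_gt0.
  lra.
by rewrite /rate ge_max !le_max lexx /= q_noninc // orbT.
Qed.

(** If the price chosen at [x] is nonnegative, its line majorizes the separation function and
    touches it at [x]. Otherwise the rate is 0, and the claim is that the separation function
    divided by the cost is nonincreasing, which follows from nonnegative truncated prices. *)
Lemma rate_envelope (x y : R) : 0 < x -> x < y ->
  rate x * (y - x) <= y * separation trunc_scheme x - x * separation trunc_scheme y.
Proof.
move=> x0 xy; have y0 := lt_trans x0 xy.
have [t0 t1 _] := tstarP _ x0; rewrite /rate; set t := tstar q x in t0 t1 *.
case: (leP 0 (q t)) => qt; last first.
  have -> : trunc_scheme t = 0 by rewrite /trunc_scheme max_l // ltW.
  rewrite mul0r subr_ge0 mulrC -ler_pdivrMl //.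
  apply: le_separation => s s0; rewrite ler_pdivrMl //.
  have := ler_wpM2r (ltW x0) (separation_le _ trunc_scheme_ge0 _ _ (ltW y0) s0).
  have := ler_wpM2r (trunc_scheme_ge0 _ s0) (ltW xy).
  lra.
have hx : q t + x * t <= separation trunc_scheme x.
  apply: le_separation => s s0; apply: le_trans (t1 _ s0) _.
  by rewrite lerD2r le_trunc_scheme.
have hy := separation_le _ trunc_scheme_ge0 _ _ (ltW y0) t0.
have qE : trunc_scheme t = q t by rewrite /trunc_scheme max_r.
rewrite qE in hy *.
have := ler_wpM2l (ltW y0) hx; have := ler_wpM2l (ltW x0) hy.
lra.
Qed.

Lemma payment_le_valuation (x v : R) : 0 <= x -> 0 <= v -> payment q x v <= v.
Proof.
move=> x0 v0; rewrite /payment; case: ifP => // h; apply: le_trans h.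
by rewrite lerDl mulr_ge0 // tstar_ge0.
Qed.

Lemma payment_le_rate (x v : R) : payment q x v <= rate x.
Proof.
by rewrite /payment; case: ifP => _; [exact: le_trunc_scheme|rewrite le_max lexx].
Qed.

(** A positive price is unchanged by truncation, so the chosen time also bounds the truncated
    separation function. *)
Lemma payment_gt0 (x v : R) : 0 <= x -> 0 < payment q x v ->
  separation trunc_scheme x <= v.
Proof.
move=> x0; rewrite /payment; case: ifP => [h q0|]; last by rewrite ltxx.
apply: le_trans (separation_le _ trunc_scheme_ge0 _ _ x0 (tstar_ge0 q x)) _.
by rewrite /trunc_scheme max_r // ltW.
Qed.

End Scheme.

(** * Upper bound on the revenue of any scheme *)

Section UpperBound.
Context {R : realType}.
Local Open Scope classical_set_scope.
Variable m : nat.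
Hypothesis m_gt0 : (0 < m)%N.
Notation step := (@step R m).
Notation node := (@node R m).

Lemma revenue_le (q : R -> R) : nonincreasing_scheme q -> well_defined_scheme q ->
  (revenue q <= (22 / 27 + 20 * step)%:E)%E.
Proof.
move=> q_noninc q_wd.
have s0 := step_gt0 m m_gt0 : 0 < step; have s1 := step_le m m_gt0 : step <= _.
set l := separation (trunc_scheme q); set r := rate q.
have l_homo := separation_homo _ (trunc_scheme_ge0 q).
have r_ge0 x : 0 <= r x by rewrite le_max lexx.
have up := upper_sum m m_gt0 l r l_homo (separation_ge0 _ (trunc_scheme_ge0 q))
  (fun x _ => r_ge0 x) (rate_homo q q_noninc q_wd) (rate_envelope q q_wd).
(* Heights include the density 1/2. The first cell touches cost 0, where a minimizer may fail to
   exist, so only the bound 3 on valuations is used there. *)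
pose k i : R := if i is 0%N then 3 / 2 else Num.min (r (node i.+1)) 3 / 2.
(* Cutting at the diagonal v = theta matches the truncation of [clamp] at 1. *)
pose lo i : R := if i is 0%N then 0 else Num.max (l (node i)) (node i).
pose A i : set R := `[node i, node i.+1].
pose B i : set R := `[lo i, 1 + node i.+1].
have k0 i : 0 <= k i.
  case: i => [|i]; first by rewrite /k; lra.
  by rewrite divr_ge0 // le_min r_ge0 /=; lra.
have bound (x v : R) : density (x, v) * payment q x v <= boxes (3 * m) k A B (x, v).
  rewrite /density; case: asboolP => [[/= x02 vx]|_]; last first.
    by rewrite mul0r boxes_ge0.
  have [x0 x2] := andP x02.
  have [pay0|pay0] := leP (payment q x v) 0.
    by apply: le_trans (boxes_ge0 _ _ _ _ _ k0); rewrite pmulr_rle0 // invr_gt0.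
  have [i i3 ix] : exists2 i, (i < 3 * m)%N & node i <= x <= node i.+1.
    by apply: node_cell => //; rewrite ?muln_gt0 ?node_3m.
  have payv : payment q x v <= v by apply: payment_le_valuation => //; lra.
  have [ix1 ix2] := andP ix.
  apply: le_trans (boxes_ge (3 * m) k A B (x, v) i k0 i3 _ _).
  - rewrite mulrC; case: i {i3} ix ix1 ix2 => [|i] ix ix1 ix2 /=.
      by rewrite ler_wpM2r ?invr_ge0 //; lra.
    rewrite ler_wpM2r ?invr_ge0 // le_min; apply/andP; split; last by lra.
    apply: le_trans (payment_le_rate q x v) _; apply: rate_homo => //.
    exact: lt_le_trans (node_gt0 m m_gt0 _ _) ix1.
  - by rewrite /A /= in_itv /=.
  - rewrite /B /= in_itv /=; apply/andP; split; last by lra.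
    case: i {i3} ix ix1 ix2 => [|i] ix ix1 ix2 /=; first by lra.
    rewrite ge_max; apply/andP; split; last by lra.
    apply: le_trans (payment_gt0 q x v x0 pay0); apply: l_homo => //.
    exact: node_gt0.
apply: (@le_trans _ _ (\int[(@lebesgue_measure R) \x (@lebesgue_measure R)]_(x in setT)
    (boxes (3 * m) k A B x)%:E)%E).
  apply: le_integral_nonmeasurable => [x|[x v]]; rewrite lee_fin.
    exact: boxes_ge0.
  exact: bound.
rewrite (integral_boxes _ _ _ _ (fun i => Num.max 0 (node i.+1 - node i))
   (fun i => Num.max 0 (1 + node i.+1 - lo i))) //; last 4 first.
- by move=> i; exact: measurable_itv.
- by move=> i; exact: measurable_itv.
- by move=> i; exact: lebesgue_measure_itv_max.
- by move=> i; exact: lebesgue_measure_itv_max.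
rewrite lee_fin.
have -> : \sum_(i < 3 * m) k i * (Num.max 0 (node i.+1 - node i) * Num.max 0 (1 + node i.+1 - lo i))
  = \sum_(0 <= i < 3 * m) k i * (step * Num.max 0 (1 + node i.+1 - lo i)).
  rewrite big_mkord; apply: eq_bigr => i _.
  by rewrite nodeS addrAC subrr add0r [Num.max 0 step]max_r // ltW.
rewrite big_ltn ?muln_gt0 //.
have first_term : k 0%N * (step * Num.max 0 (1 + node 1 - lo 0%N)) <= 5 / 2 * step.
  by rewrite /k /lo node1 subr0 max_r ?addr_ge0 ?(ltW s0) //; nra.
have rest : \sum_(1 <= i < 3 * m) k i * (step * Num.max 0 (1 + node i.+1 - lo i)) <=
    2^-1 * \sum_(1 <= i < 3 * m) Num.min (r (node i.+1)) 3 * (step * (demand l (node i) + step)).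
  rewrite mulr_sumr; apply: ler_sum_nat => -[//|i] _.
  rewrite /k /lo /demand; set M := Num.min _ _; set b := Num.max 0 _.
  have M0 : 0 <= M by rewrite le_min r_ge0 /=; lra.
  set d := clamp _; have bd : b <= d + step.
    have d0 : 0 <= d := clamp_ge0 _.
    rewrite /b ge_max; apply/andP; split; first by lra.
    rewrite [node i.+2]nodeS /d.
    case: (clamp_cases (1 - (l (node i.+1) - node i.+1))) => -[h ->];
      case: (leP (l (node i.+1)) (node i.+1)) => h'; lra.
  by have := ler_wpM2l M0 (ler_wpM2l (ltW s0) bd); lra.
(* Half of 29 steps plus 5/2 for the first cell makes 17, below 20. *)
lra.
Qed.

End UpperBound.

(** * Behaviour and revenue of [p_opt] *)

Section OptimalScheme.
Context {R : realType}.
Local Open Scope classical_set_scope.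
Variable m : nat.
Hypothesis m_gt0 : (0 < m)%N.
Notation step := (@step R m).
Notation node := (@node R m).
Notation popt := (@p_opt R).

Lemma p_opt_ge (t : R) : 2 / 3 <= popt t.
Proof. by rewrite /p_opt; case: ifP => _; lra. Qed.

Lemma p_opt_noninc : nonincreasing_scheme popt.
Proof. by move=> s t s0 st; rewrite /p_opt; case: ltP => t1; case: ltP => s1; lra. Qed.

(** At cost 2/3 the times 0 and 1 tie and the smaller one is chosen, hence the strict comparison. *)
Lemma p_opt_minimizer (x : R) : 0 <= x ->
  smallest_minimizer popt x (if x < 2 / 3 then 1 else 0).
Proof.
move=> x0; case: ltP => x1; split => //.
- by move=> s s0; rewrite /p_opt ltxx; case: ltP => s1; nra.
- by move=> s s0; rewrite /p_opt ltxx; case: ltP => s1; nra.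
- by move=> s s0; rewrite /p_opt ltr01; case: ltP => s1; nra.
Qed.

Lemma p_opt_well_defined : well_defined_scheme popt.
Proof. by move=> x x0; eexists; apply: p_opt_minimizer; exact: ltW. Qed.

Lemma payment_p_opt (x v : R) : 0 <= x ->
  payment popt x v =
    if x < 2 / 3 then (if 2 / 3 + x <= v then 2 / 3 else 0)
    else if 4 / 3 <= v then 4 / 3 else 0.
Proof.
move=> x0; rewrite /payment (tstar_eq _ _ _ (p_opt_minimizer _ x0)) /p_opt.
by case: (ltP x) => x1; rewrite ?ltxx ?mulr1 ?ltr01 ?mulr0 ?addr0.
Qed.

Lemma separation_p_opt (x : R) : 0 <= x ->
  separation popt x = if x <= 2 / 3 then 2 / 3 + x else 4 / 3.
Proof.
move=> x0; have [t0 t1 _] := p_opt_minimizer _ x0.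
rewrite (separation_min _ _ _ t0 t1) /p_opt.
by case: (ltP x) => x1; rewrite ?ltxx ?ltr01; case: leP => x2; lra.
Qed.

(* Antiderivative of the revenue that [p_opt] collects from buyers of cost [x]. *)
Definition revenue_below (x : R) : R :=
  if x <= 2 / 3 then x / 9
  else if x <= 4 / 3 then 2 / 27 + 2 / 3 * ((x - 1 / 3) ^+ 2 / 2 - 1 / 18)
  else 10 / 27 + 2 / 3 * (x - 4 / 3).

Lemma revenue_below_mid (x : R) : 2 / 3 <= x <= 4 / 3 ->
  revenue_below x = 2 / 27 + 2 / 3 * ((x - 1 / 3) ^+ 2 / 2 - 1 / 18).
Proof.
move=> /andP[x1 x2]; rewrite /revenue_below x2; case: leP => // x1'.
by rewrite (_ : x = 2 / 3); [field|lra].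
Qed.

Lemma revenue_below_high (x : R) : 4 / 3 <= x ->
  revenue_below x = 10 / 27 + 2 / 3 * (x - 4 / 3).
Proof.
move=> x1; rewrite /revenue_below ifF; last by apply/negbTE; rewrite -ltNge; lra.
case: leP => // x2.
by rewrite (_ : x = 4 / 3); [field|lra].
Qed.

Lemma revenue_p_opt_ge : ((22 / 27 - 2 * step)%:E <= revenue popt)%E.
Proof.
have s0 := step_gt0 m m_gt0 : 0 < step.
(* Inscribed boxes: heights are half the price, the lower edge is taken at the right end of the cell
   and the upper edge at the left end. *)
pose k i : R := if (i < m)%N then 1 / 3 else 2 / 3.
pose lo i : R := if (i < m)%N then 2 / 3 + node i.+1 else Num.max (4 / 3) (node i.+1).
pose A i : set R := `[node i, node i.+1[.
pose B i : set R := `[lo i, 1 + node i].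
have k0 i : 0 <= k i by rewrite /k; case: ifP => _; lra.
have pay0 x v : 0 <= payment popt x v.
  by rewrite /payment; case: ifP => // _; have := p_opt_ge (tstar popt x); lra.
have den0 x : 0 <= density x :> R by rewrite /density; case: ifP.
have bound (x v : R) : boxes (3 * m) k A B (x, v) <= density (x, v) * payment popt x v.
  apply: le_boxes.
  - by rewrite mulr_ge0.
  - move=> i j; rewrite /A /= !in_itv /= => /andP[i1 i2] /andP[j1 j2].
    apply/eqP; rewrite eqn_leq; apply/andP; split; rewrite leqNgt; apply/negP => ij;
      have := node_le m m_gt0 _ _ ij : _ <= _ :> R; lra.
  - move=> i i3; rewrite /A /B /= !in_itv /= => /andP[i1 i2] /andP[v1 v2].
    have x0 : 0 <= x := le_trans (node_ge0 m m_gt0 i) i1.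
    have x2 : node i.+1 <= 2 by rewrite -(node_3m m m_gt0) node_le.
    have supp : Defs.support (x, v) /\ k i <= 2^-1 * payment popt x v; last first.
      by rewrite /density asboolT //; case: supp.
    rewrite payment_p_opt // /k /Defs.support /=; move: v1; rewrite /lo.
    case: ifP => im v1.
      have xm : node i.+1 <= 2 / 3 by rewrite -(node_m m m_gt0) node_le.
      rewrite ifT ?ifT; [|lra..]; split; [split|]; lra.
    have xm : 2 / 3 <= node i.
      by rewrite -(node_m m m_gt0) node_le // leqNgt im.
    move: v1; rewrite ge_max => /andP[v1 v3].
    rewrite ifF; last by apply/negbTE; rewrite -leNgt; lra.
    rewrite v1; split; [split|]; lra.
apply: (@le_trans _ _ (\int[(@lebesgue_measure R) \x (@lebesgue_measure R)]_(x in setT)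
    (boxes (3 * m) k A B x)%:E)%E); last first.
  apply: le_integral_nonmeasurable => [x|[x v]]; rewrite lee_fin ?mulr_ge0 //; exact: bound.
rewrite (integral_boxes _ _ _ _ (fun i => Num.max 0 (node i.+1 - node i))
   (fun i => Num.max 0 (1 + node i - lo i))) //; last 4 first.
- by move=> i; exact: measurable_itv.
- by move=> i; exact: measurable_itv.
- by move=> i; exact: lebesgue_measure_itv_max.
- by move=> i; exact: lebesgue_measure_itv_max.
rewrite lee_fin -(big_mkord xpredT
  (fun i => k i * (Num.max 0 (node i.+1 - node i) * Num.max 0 (1 + node i - lo i)))).
(* The subtracted term allows a loss of [step ^+ 2] per cell, [2 * step] in all. *)
pose F i := revenue_below (node i) - step * node i.
apply: (@le_trans _ _ (F (3 * m)%N - F 0%N)).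
  rewrite /F node0 node_3m // revenue_below_high; last by lra.
  by rewrite /revenue_below ifT; lra.
rewrite -(telescope_sumr F) //; apply: ler_sum_nat => i /andP[_ i3]; rewrite /F.
have e1 := nodeS m i : node i.+1 = node i + step.
have -> : Num.max 0 (node i.+1 - node i) = step.
  by rewrite e1 addrAC subrr add0r max_r // ltW.
have i0 := node_ge0 m m_gt0 i : 0 <= node i.
set b := Num.max 0 _; have b0 : 1 + node i - lo i <= b by rewrite le_max lexx orbT.
have -> : step * node i.+1 = step * node i + step ^+ 2 by rewrite e1; ring.
have H := ler_wpM2l (k0 i) (ler_wpM2l (ltW s0) b0).
apply: le_trans H => {b b0}; rewrite /k /lo.
case: ifP => im.
  have xm : node i.+1 <= 2 / 3 by rewrite -(node_m m m_gt0) node_le.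
  rewrite /revenue_below !ifT; [|lra..].
  rewrite e1; nra.
have xm : 2 / 3 <= node i by rewrite -(node_m m m_gt0) node_le // leqNgt im.
have := sqr_ge0 step => ss.
(* Up to cost 4/3 the lower edge is the price 4/3; beyond, it is the edge v = theta of the
   support. *)
have [xm2|xm2] := node_split m m_gt0 i (2 * m) : _ <= _ :> R \/ _ <= _ :> R.
  rewrite node_2m // in xm2; rewrite max_l // !revenue_below_mid; [|lra..].
  rewrite e1; lra.
rewrite node_2m // in xm2; rewrite max_r; last by lra.
rewrite !revenue_below_high; [|lra..].
rewrite e1; lra.
Qed.

End OptimalScheme.

Theorem theorem5 (R : realType) :
  [/\ nonincreasing_scheme (@p_opt R),
      well_defined_scheme (@p_opt R),
      (forall q : R -> R, nonincreasing_scheme q -> well_defined_scheme q ->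
         (revenue q <= revenue (@p_opt R))%E) &
      (forall theta : R, 0 <= theta ->
         separation (@p_opt R) theta =
           (if theta <= 2 / 3 then 2 / 3 + theta else 4 / 3))].
Proof.
split; [exact: p_opt_noninc|exact: p_opt_well_defined| |exact: separation_p_opt].
move=> q q_noninc q_wd; apply/lee_addgt0Pr => e e0.
(* The two bounds differ by 22 steps, that is 44/(3m), and 44/3 < 15. *)
pose m := (Num.truncn (15 / e)).+1.
have m_gt0 : (0 < m)%N by [].
have me : 15 / e < m%:R :> R by exact: truncnS_gt.
have se : 22 * step m <= e.
  have := mR_gt0 (R := R) m m_gt0 => m0.
  rewrite /step mulrA ler_pdivrMr ?mulr_gt0 //.
  move: me; rewrite ltr_pdivrMr //; lra.
apply: le_trans (revenue_le m m_gt0 q q_noninc q_wd) _.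
apply: le_trans (leeD2r _ (revenue_p_opt_ge m m_gt0)).
by rewrite lee_fin; lra.
Qed.
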